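(* Every compact connected manifold $M$ with a Riemannian foliation $\mathcal{F}$ of codimension one has infinite fundamental group.
   Context: A foliation $\mathcal{F}$ on $M$ is Riemannian if $M$ admits a bundle-like metric, i.e. a Riemannian metric such that the induced metric on the normal bundle $TM/T\mathcal{F}\cong T\mathcal{F}^\perp$ is holonomy invariant. *)

(* Defs.v *)
From HB Require Import structures.
From mathcomp Require Import all_boot all_order all_algebra.
From mathcomp Require Import all_classical all_reals all_analysis.

Set Implicit Arguments.
Unset Strict Implicit.
Unset Printing Implicit Defensive.

Import Order.TTheory GRing.Theory Num.Theory.
Import numFieldNormedType.Exports.

Local Open Scope classical_set_scope.
Local Open Scope ring_scope.

Fixpoint Ck (R : realType) (V W : normedModType R) (k : nat) (U : set V)
    (f : V -> W) : Prop :=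
  if k is k'.+1 then
    (forall z, U z -> differentiable f z) /\ forall v, Ck k' U ('D_v f)
  else forall z, U z -> {for z, continuous f}.

(* Meant for open U only, so that derivatives on U depend only on f on U. *)
Definition smooth_on (R : realType) (V W : normedModType R) (U : set V)
  (f : V -> W) : Prop := forall k, Ck k U f.

(* A chart is a homeomorphism from an open set of M onto an open set of R^n;
   both maps are total, with irrelevant values off these open sets. *)
Record chart (R : realType) (n : nat) (M : topologicalType) := Chart {
  cdom : set M;
  cfun :> M -> 'rV[R]_n;
  cinv : 'rV[R]_n -> M;
  cdom_open : open cdom;
  cimg_open : open (cfun @` cdom);
  cfun_cont : forall x, cdom x -> {for x, continuous cfun};
  cinv_cont : forall z, (cfun @` cdom) z -> {for z, continuous cinv};
  cfunK : forall x, cdom x -> cinv (cfun x) = x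
}.

Section Charts.
Context {R : realType} {n : nat} {M : topologicalType}.
Implicit Types phi psi : chart R n M.

Definition transition phi psi : 'rV[R]_n -> 'rV[R]_n := psi \o cinv phi.

Definition transition_dom phi psi : set 'rV[R]_n :=
  phi @` (cdom phi `&` cdom psi).

Definition compatible phi psi : Prop :=
  smooth_on (transition_dom phi psi) (transition phi psi) /\
  smooth_on (transition_dom psi phi) (transition psi phi).

End Charts.

Record smooth_manifold (R : realType) (n : nat) := SmoothManifold {
  carrier :> topologicalType;
  carrier_hausdorff : hausdorff_space carrier;
  carrier_second_countable : @second_countable carrier;
  atlas : set (chart R n carrier);
  atlas_cover : forall x, exists2 phi, atlas phi & cdom phi x;
  atlas_compatible :
    forall phi psi, atlas phi -> atlas psi -> compatible phi psi
}.

(* The charts of the maximal atlas of M. *)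
Definition smooth_chart (R : realType) (n : nat) (M : smooth_manifold R n)
    (phi : chart R n M) : Prop :=
  forall psi, atlas psi -> compatible phi psi.

(* A tangent vector at x is given by its coordinates in all smooth charts
   around x, related by the differentials of the coordinate changes; vectors
   are rows, so linear maps act on the right. The values of tcoord at charts
   whose domain does not contain x are irrelevant. *)
Record tangent (R : realType) (n : nat) (M : smooth_manifold R n) (x : M) :=
  Tangent {
  tcoord :> chart R n M -> 'rV[R]_n;
  tcoord_change : forall phi psi, smooth_chart phi -> smooth_chart psi ->
    cdom phi x -> cdom psi x ->
    tcoord psi = tcoord phi *m jacobian (transition phi psi) (phi x)
}.

Record riemannian_metric (R : realType) (n : nat) (M : smooth_manifold R n) :=
  RiemannianMetric {
  inner :> forall x : M, tangent x -> tangent x -> R;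
  inner_local : forall phi, smooth_chart phi ->
    exists G : 'rV[R]_n -> 'M[R]_n,
    [/\ smooth_on (phi @` cdom phi) G,
        forall x, cdom phi x -> (G (phi x))^T = G (phi x),
        forall x (a : 'rV[R]_n), cdom phi x -> a != 0 ->
          0 < (a *m G (phi x) *m a^T) 0 0
      & forall x (v w : tangent x), cdom phi x ->
          inner v w = (v phi *m G (phi x) *m (w phi)^T) 0 0]
}.

(* A smooth foliation with leaves of dimension p and codimension q, given by
   a foliated atlas: writing points of R^(p + q) as (a, b), the coordinate
   changes are locally of the form (a, b) |-> (h1 (a, b), h b). The transverse
   coordinates b are extracted by rsubmx. *)
Record foliation (R : realType) (p q : nat) (M : smooth_manifold R (p + q)) :=
  Foliation {
  fol_atlas : set (chart R (p + q) M);
  fol_smooth : forall phi, fol_atlas phi -> smooth_chart phi;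
  fol_cover : forall x, exists2 phi, fol_atlas phi & cdom phi x;
  fol_transverse : forall phi psi, fol_atlas phi -> fol_atlas psi ->
    forall z, transition_dom phi psi z ->
    exists h : 'rV[R]_q -> 'rV[R]_q,
      \forall z' \near z, rsubmx (transition phi psi z') = h (rsubmx z')
}.

Section Foliations.
Context {R : realType} {p q : nat} {M : smooth_manifold R (p + q)}.
Variables (F : foliation M) (g : riemannian_metric M).

Definition tangent_to_leaf (x : M) (u : tangent x) : Prop :=
  forall phi, fol_atlas F phi -> cdom phi x -> rsubmx (u phi) = 0.

Definition normal_to_leaf (x : M) (v : tangent x) : Prop :=
  forall u : tangent x, tangent_to_leaf u -> g x u v = 0.

(* A path lying in one leaf, continuous for the topology of the leaf. *)
Definition leafwise_path (c : R -> M) : Prop :=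
  {within `[0, 1], continuous c} /\
  forall phi (t : R), fol_atlas F phi -> t \in `[0, 1] -> cdom phi (c t) ->
    \forall s \near t, s \in `[0, 1] ->
      rsubmx (phi (c s)) = rsubmx (phi (c t)).

(* v represents a section of TM/TF along the leafwise path c. Sliding a
   transversal along the plaques of a foliated chart keeps the transverse
   coordinates fixed, so v is carried along by the (linear) holonomy of c if
   and only if its transverse components are locally constant in every
   foliated chart: v 1 mod TF is then the holonomy image of v 0 mod TF. *)
Definition holonomy_transported (c : R -> M) (v : forall t, tangent (c t))
    : Prop :=
  forall phi (t : R), fol_atlas F phi -> t \in `[0, 1] -> cdom phi (c t) ->
    \forall s \near t, s \in `[0, 1] ->
      rsubmx (v s phi) = rsubmx (v t phi).

(* Classes in TM/TF are represented by vectors orthogonal to F, on which the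
   induced metric of TM/TF is g itself. *)
Definition bundle_like : Prop :=
  forall c : R -> M, leafwise_path c ->
  forall v w : (forall t, tangent (c t)),
    (forall t : R, t \in `[0, 1] -> normal_to_leaf (v t)) ->
    (forall t : R, t \in `[0, 1] -> normal_to_leaf (w t)) ->
    holonomy_transported v -> holonomy_transported w ->
    g (c 1) (v 1) (w 1) = g (c 0) (v 0) (w 0).

End Foliations.

Definition riemannian_foliation (R : realType) (p q : nat)
    (M : smooth_manifold R (p + q)) (F : foliation M) : Prop :=
  exists g : riemannian_metric M, bundle_like F g.

Section FundamentalGroup.
Context {R : realType} {M : topologicalType}.
Implicit Types (x : M) (c d : R -> M).

(* Only the values on [0, 1] of a loop are relevant. *)
Definition loop_at x : set (R -> M) :=
  [set c : R -> M | [/\ {within `[0, 1], continuous c}, c 0 = x & c 1 = x]].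

Definition unit_square : set (R * R) :=
  [set` `[0, 1]] `*` [set` `[0, 1]].

Definition homotopic_loops x c d : Prop :=
  exists H : R * R -> M,
    [/\ {within unit_square, continuous H},
        forall t : R, t \in `[0, 1] -> H (0, t) = c t,
        forall t : R, t \in `[0, 1] -> H (1, t) = d t
      & forall s : R, s \in `[0, 1] -> H (s, 0) = x /\ H (s, 1) = x].

Definition homotopy_class x c : set (R -> M) :=
  [set d | loop_at x d /\ homotopic_loops x c d].

(* The underlying set of the fundamental group of M at x. *)
Definition pi1 x : set (set (R -> M)) := homotopy_class x @` loop_at x.

End FundamentalGroup.

(* Main.v *)
Require Import Defs.
From HB Require Import structures.
From mathcomp Require Import all_boot all_order all_algebra.
From mathcomp Require Import all_classical all_reals all_analysis.
From mathcomp Require Import lra.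

(** Why the theorem holds.  In codimension one a bundle-like metric measures
    the transverse direction: if [lambda] is the squared length of the normal
    vector whose transverse coordinate is 1, holonomy invariance makes
    [lambda] constant along plaques, hence locally a function of the transverse
    coordinate [b] of a foliated chart ([transverse_density_plaque]).  Replacing [b] by a primitive of
    [sqrt lambda], that is by transverse arc length, yields local submersions
    to the line which are constant along the leaves, and any two of which
    differ by an isometry [u |-> s * u + k] with [s = 1] or [s = -1]
    ([isometric_coordinate_unique]).

    Such germs can be continued along every path, uniquely, and the result
    depends only on the homotopy class of the path
    ([continuation_homotopy]).  Hence, a germ [f] being fixed at the base
    point [x], the value at [x] of the germ obtained by continuing [f] along a
    loop is an invariant of the class of that loop.  It remains to see that
    this invariant is unbounded.  By compactness some fixed amount [e > 0]
    can always be gained by moving inside one chart ([transport_gain]), so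
    arbitrarily large values are reached at the end of some path starting from
    [x]; and by compactness and connectedness one can come back to [x] at the
    expense of a bounded loss ([transport_back]).  So loops at [x] reach
    arbitrarily large values ([transport_loop_unbounded]), and there are
    infinitely many homotopy classes.

    The sign [s] of the identification may change along a loop.  This is
    harmless because the gain is available in both directions of the line, and
    it replaces the usual passage to a transversely oriented double covering. *)

Set Implicit Arguments.
Unset Strict Implicit.
Unset Printing Implicit Defensive.

Import Order.TTheory GRing.Theory Num.Theory.
Import numFieldNormedType.Exports.

Local Open Scope classical_set_scope.
Local Open Scope ring_scope.

(** * Calculus on the line and segments *)

Section Calculus.
Context {R : realType}.
Implicit Types (f P Q dP dQ : R -> R).

Lemma is_derive_continuous f df (t : R) : is_derive t 1 f df ->
  {for t, continuous f}.
Proof.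
by move=> [/derivable1_diffP dft _]; exact: differentiable_continuous.
Qed.

Lemma primitive_exists f (a b : R) : a < b ->
  (forall t, a <= t <= b -> {for t, continuous f}) ->
  exists P, forall t, a < t < b -> is_derive t 1 P (f t).
Proof.
move=> ab fc.
have fi : (@lebesgue_measure R).-integrable `[a, b] (EFin \o f).
  apply: continuous_compact_integrable; first exact: segment_compact.
  apply: continuous_in_subspaceT => t; rewrite inE /= in_itv /=; exact: fc.
exists (fun x => (\int[@lebesgue_measure R]_(t in [set` `[a, x]]) f t)%R).
move=> t /andP[at_ tb].
have [|dF <-] := @continuous_FTC1_closed R f a t b tb fi at_.
  by apply: fc; rewrite !ltW.
by rewrite derive1E; exact: derivableP.
Qed.

Lemma derive_MVT f df (a b : R) (s t : R) :
  (forall t, a < t < b -> is_derive t 1 f (df t)) ->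
  a < s -> s < t -> t < b -> exists2 c, s < c < t & f t - f s = df c * (t - s).
Proof.
move=> fd as_ st tb.
have [c| |c cst E] := @MVT R f df s t st.
- by rewrite in_itv /= => /andP[? ?]; apply: fd; lra.
- apply: continuous_in_subspaceT => c; rewrite inE /= in_itv /= => /andP[? ?].
  by apply: (@is_derive_continuous _ (df c)); apply: fd; lra.
by exists c => //; move: cst; rewrite in_itv.
Qed.

(** Continuity of [df] is not assumed: by the mean value theorem [f] is
    injective, hence monotone, which fixes the sign of its derivative. *)
Lemma derive_sign f df (a b : R) :
  (forall t, a < t < b -> is_derive t 1 f (df t)) ->
  (forall t, a < t < b -> df t != 0) ->
  (forall t, a < t < b -> 0 < df t) \/ (forall t, a < t < b -> df t < 0).
Proof.
move=> fd df0.
have fder t : t \in `]a, b[ -> derivable f t 1.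
  by rewrite in_itv /= => /fd[].
have fdE t : a < t < b -> derive1 f t = df t by move=> /fd[_ <-]; rewrite derive1E.
have finj : {in `]a, b[ &, injective f}.
  move=> s t; wlog st : s t / s < t.
    move=> H sab tab fst; have [st|ts|//] := ltgtP s t; first exact: H.
    exact/esym/H.
  rewrite !in_itv /= => /andP[as_ _] /andP[_ tb] fst.
  have [c /andP[sc ct]] := derive_MVT fd as_ st tb.
  rewrite fst subrr => /esym/eqP; rewrite mulf_eq0 subr_eq0 (gt_eqF st) orbF.
  by rewrite (negbTE (df0 _ _)) //; lra.
have fcont : {within [set` `]a, b[], continuous f}.
  apply: continuous_in_subspaceT => t; rewrite inE /= in_itv /= => /fd.
  exact: is_derive_continuous.
have [inc|dec] := itv_continuous_inj_mono fcont finj; [left|right] => t tab.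
- rewrite lt_neqAle eq_sym df0 //= -fdE //.
  apply: (incr_derive1_ge0_itv (b0 := false) (b1 := true) (a := a) (b := b)).
  + by move=> s /[!inE] /=; exact: fder.
  + exact: inc.
  + by rewrite in_itv.
- rewrite lt_neqAle df0 //= -fdE //.
  apply: (decr_derive1_le0_itv (b0 := false) (b1 := true) (a := a) (b := b)).
  + by move=> s /[!inE] /=; exact: fder.
  + by move=> s u sab uab us; exact: dec.
  + by rewrite in_itv.
Qed.

(** At each point the two derivatives agree up to sign, and since each of them
    has a constant sign, so does their quotient.  Transverse arc length is only
    known through the square of its derivative; this makes it unique up to an
    isometry of the line. *)
Lemma eq_sqr_derive P Q dP dQ (a b : R) :
  (forall t, a < t < b -> is_derive t 1 P (dP t)) ->
  (forall t, a < t < b -> is_derive t 1 Q (dQ t)) ->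
  (forall t, a < t < b -> dP t != 0 /\ dQ t ^+ 2 = dP t ^+ 2) ->
  exists s k : R, (s = 1 \/ s = -1) /\
    forall t, a < t < b -> Q t = s * P t + k.
Proof.
move=> Pd Qd sq.
have dP0 t : a < t < b -> dP t != 0 by case/sq.
have dQ0 t : a < t < b -> dQ t != 0.
  by move=> tab; rewrite -sqrf_eq0 (sq _ tab).2 sqrf_eq0 dP0.
have [s s1 dQE] : exists2 s : R, s = 1 \/ s = -1 &
    forall t, a < t < b -> dQ t = s * dP t.
  have cases t : a < t < b -> dQ t = dP t \/ dQ t = - dP t.
    by move=> /sq[_ /eqP]; rewrite eqf_sqr => /orP[]/eqP ->; [left|right].
  have [Pp|Pn] := derive_sign Pd dP0; have [Qp|Qn] := derive_sign Qd dQ0.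
  - exists 1; [by left|] => t tab; have := Pp _ tab; have := Qp _ tab.
    by case: (cases _ tab) => ->; lra.
  - exists (-1); [by right|] => t tab; have := Pp _ tab; have := Qn _ tab.
    by case: (cases _ tab) => ->; lra.
  - exists (-1); [by right|] => t tab; have := Pn _ tab; have := Qp _ tab.
    by case: (cases _ tab) => ->; lra.
  - exists 1; [by left|] => t tab; have := Pn _ tab; have := Qn _ tab.
    by case: (cases _ tab) => ->; lra.
pose D t := Q t - s * P t.
have Dd t : a < t < b -> is_derive t 1 D 0.
  move=> tab; have := Qd _ tab; have := Pd _ tab => dPt dQt.
  have -> : D = Q - s *: P by [].
  have DE := is_deriveB dQt (is_deriveZ s dPt).
  by apply: is_derive_eq DE _; rewrite dQE // -[s *: _]/(s * _) subrr.
have Dcst t u : a < t -> t < u -> u < b -> D t = D u.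
  move=> at_ tu ub; have [c _] := derive_MVT Dd at_ tu ub.
  by rewrite mul0r => /eqP; rewrite subr_eq0 => /eqP.
exists s, (D ((a + b) / 2)); split => // t /andP[at_ tb].
suff <- : D t = D ((a + b) / 2) by rewrite /D addrC subrK.
have [tm|mt|->//] := ltgtP t ((a + b) / 2).
- by apply: Dcst => //; lra.
- by apply/esym; apply: Dcst => //; lra.
Qed.

End Calculus.

Section Convex.
Context {R : realType} {V : normedModType R}.

Lemma ball_segment (z a b : V) (r t : R) : 0 <= t <= 1 ->
  `|z - a| < r -> `|z - b| < r -> `|z - (a + t *: (b - a))| < r.
Proof.
move=> /andP[t0 t1] ar br.
have -> : z - (a + t *: (b - a)) = (1 - t) *: (z - a) + t *: (z - b).
  rewrite scalerBl scale1r -addrA [X in _ = _ + X]addrC -scalerBr opprB.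
  by rewrite [z - b + _]addrC addrA subrK opprD -scalerN opprB addrA.
apply: le_lt_trans (ler_normD _ _) _; rewrite !normrZ.
rewrite !ger0_norm ?subr_ge0 //.
have [ab|ba] := leP `|z - a| `|z - b|.
- apply: le_lt_trans br.
  have : (1 - t) * `|z - a| <= (1 - t) * `|z - b|.
    by apply: ler_wpM2l => //; rewrite subr_ge0.
  lra.
- apply: le_lt_trans ar.
  have : t * `|z - b| <= t * `|z - a| by apply: ler_wpM2l => //; exact: ltW.
  lra.
Qed.

End Convex.

(** * Paths parametrised by the line *)

(** Real induction in the form used for continuation along a path: a property
    that propagates to the right inside a neighbourhood of each point
    propagates along every interval. *)
Lemma interval_chaining (R : realType) (P : R -> Prop) (a b : R) :
  a <= b ->
  (forall t : R, exists2 B : set R, nbhs t B &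
     forall s s', a <= s -> s <= s' -> (forall r, s <= r <= s' -> B r) ->
       P s -> P s') ->
  P a -> P b.
Proof.
move=> ab step Pa.
pose S := [set t | a <= t <= b /\ P t].
have Sa : S a by split => //; rewrite lexx.
have hS : has_sup S by split; [exists a | exists b => t [/andP[]]].
set T := sup S.
have [B [e /= e0 eB] PB] := step T.
have [s [/andP[sa sb] Ps] sT] := sup_adherent e0 hS.
rewrite -/T in sT; have ub := sup_upper_bound hS.
have sleT : s <= T by apply: ub; split => //; rewrite sa.
pose s' := Num.min b (T + e / 2).
have ss' : s <= s' by rewrite le_min sb /=; lra.
have Ps' : P s'.
  apply: (PB s) => // r /andP[r1]; rewrite le_min => /andP[_ r2].
  apply: eB; rewrite /ball_ /= ltr_norml; lra.
have Ss' : S s'.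
  by split => //; rewrite (le_trans sa ss') ge_min lexx.
have := ub _ Ss'; rewrite -/T ge_min => /orP[bT|?]; last (exfalso; lra).
suff <- : s' = b by [].
by apply/min_idPl; lra.
Qed.

(** Composing with this retraction turns a path defined on a segment into a path
    on the whole line, which avoids continuity relative to a segment. *)
Definition clamp (R : realType) (a b t : R) : R := Num.max a (Num.min b t).

Lemma continuous_clamp (R : realType) (a b : R) : continuous (clamp a b).
Proof.
move=> t; apply: continuous_max; first exact: cvg_cst.
by apply: continuous_min; [exact: cvg_cst | exact: cvg_id].
Qed.

Lemma clamp_itv (R : realType) (a b t : R) : a <= b -> a <= clamp a b t <= b.
Proof. by move=> ab; rewrite le_max lexx /= ge_max ab ge_min lexx. Qed.

Lemma clamp_id (R : realType) (a b t : R) : a <= t <= b -> clamp a b t = t.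
Proof.
by move=> /andP[at_ tb]; rewrite /clamp (min_idPr tb); apply/max_idPr.
Qed.

Lemma clamp_split (R : realType) (a b b' t : R) : a <= b -> b <= b' ->
  clamp a b' t = if t <= b then clamp a b t else clamp b b' t.
Proof.
move=> ab bb'; rewrite /clamp; case: (leP t b) => tb.
  by rewrite !(min_idPr _) //; exact: le_trans bb'.
have bm : b <= Num.min b' t by rewrite le_min bb' ltW.
by rewrite !(max_idPr _) //; exact: le_trans bm.
Qed.

Lemma continuous_within_comp (X T S : topologicalType) (A : set T)
    (f : T -> S) (g : X -> T) :
  {within A, continuous f} -> (forall x, A (g x)) -> continuous g ->
  continuous (f \o g).
Proof.
move=> fcont Ag gc x B.
have /subspace_continuousP fc := fcont.
move=> /(fc (g x) (Ag x)) /= /(gc x) /= nB; rewrite nbhs_simpl /=; move: nB.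
rewrite nbhs_simpl /=.
by apply: filterS => y /=; apply; exact: Ag.
Qed.

Lemma continuous_pair (X Y Z : topologicalType) (f : X -> Y) (g : X -> Z) :
  continuous f -> continuous g -> continuous (fun x => (f x, g x)).
Proof. by move=> fc gc x; exact: (cvg_pair (fc x) (gc x)). Qed.

Lemma continuousT_comp (X Y Z : topologicalType) (f : X -> Y) (g : Y -> Z) :
  continuous f -> continuous g -> continuous (g \o f).
Proof. by move=> fc gc x; apply: continuous_comp; [exact: fc | exact: gc]. Qed.

(** * Transverse structures modelled on the line, and their holonomy *)

Section Germs.
Context {R : realType} {M : topologicalType}.

(** A codimension-one foliation with transverse structure group the isometries
    of the line, given by the functions which may serve as transverse
    coordinates near a point; [adapted f y] is to be thought of as a property of
    the germ of [f] at [y].  The neighbourhoods in the last field play the role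
    of foliated charts; the values at [a] and [b] express that a transverse
    coordinate can be both increased and decreased, which is what fails for a
    function on a compact space and forces holonomy to appear. *)
Record transverse_structure := TransverseStructure {
  adapted : (M -> R) -> M -> Prop;
  adapted_near : forall f y, adapted f y -> \forall z \near y, adapted f z;
  adapted_affine : forall f y (s k : R), s = 1 \/ s = -1 -> adapted f y ->
    adapted (fun z => s * f z + k) y;
  adapted_unique : forall f g y, adapted f y -> adapted g y ->
    exists s k : R, (s = 1 \/ s = -1) /\ \forall z \near y, g z = s * f z + k;
  adapted_rigid : forall f y (s k : R), s = 1 \/ s = -1 -> adapted f y ->
    (\forall z \near y, f z = s * f z + k) -> s = 1 /\ k = 0;
  adapted_exists : forall y, exists U : set M, exists f : M -> R,
    [/\ open U /\ U y, (forall z, U z -> adapted f z),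
        {for y, continuous f},
        (forall a b, U a -> U b -> exists c : R -> M,
          [/\ continuous c, c 0 = a, c 1 = b & forall t, U (c t)])
      & exists a b, [/\ U a, U b & f a < f y < f b]]
}.

Arguments adapted : simpl never.

Variable S : transverse_structure.
Implicit Types (f g : M -> R) (c : R -> M) (phi psi : R -> M -> R).

(** Analytic continuation of adapted germs along [c], the germs being carried
    by globally defined functions. *)
Definition continuation c phi : Prop := forall t,
  adapted S (phi t) (c t) /\
  \forall s \near t, \forall z \near c s, phi s z = phi t z.

(** The identity principle: near [y] the two germs differ by one fixed isometry,
    and rigidity makes it trivial as soon as they agree at some point. *)
Lemma adapted_eq_near f g y : adapted S f y -> adapted S g y ->
  exists2 V : set M, open V /\ V y & forall z, V z ->
   (\forall w \near z, f w = g w) -> forall z', V z' -> f z' = g z'.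
Proof.
move=> fy gy; have [s [k [s1 fg]]] := adapted_unique fy gy.
have near_V := filterI (adapted_near fy) fg.
exists ([set z | adapted S f z /\ g z = s * f z + k]°).
  by split; [exact: open_interior | exact: near_V].
move=> z Vz fgz z' /interior_subset[_ ->].
have [fz _] := interior_subset Vz.
have [|-> ->] := adapted_rigid s1 fz (k := k); last by rewrite mul1r addr0.
by apply: filterS2 Vz fgz => w [_ <-].
Qed.

(** Agreement of the germs is both open and closed along the path. *)
Lemma continuation_unique c phi psi (a b : R) : continuous c ->
  continuation c phi -> continuation c psi -> a <= b ->
  (\forall z \near c a, phi a z = psi a z) ->
  \forall z \near c b, phi b z = psi b z.
Proof.
move=> cc cphi cpsi ab; apply: (interval_chaining (P := fun t : R =>
  \forall z \near c t, phi t z = psi t z) ab) => t.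
have [phit phin] := cphi t; have [psit psin] := cpsi t.
have [V [oV Vt] HV] := adapted_eq_near phit psit.
have nV : \forall s \near t, V (c s).
  by apply: (cc t); apply: open_nbhs_nbhs; split.
exists ([set s | [/\ V (c s), \forall z \near c s, phi s z = phi t z &
                 \forall z \near c s, psi s z = psi t z]]).
  by apply: filterS3 nV phin psin => s.
move=> s s' _ ss' B Ps.
have [|Vs phis psis] := B s; first by rewrite lexx ss'.
have [|Vs' phis' psis'] := B s'; first by rewrite lexx ss'.
have E : \forall z \near c s, phi t z = psi t z.
  by apply: filterS3 phis psis Ps => z <- <-.
have nV' : nbhs (c s') V by apply: open_nbhs_nbhs; split.
by apply: filterS3 phis' psis' nV' => z -> -> /(HV _ Vs E).
Qed.

Lemma continuation_cst c f : (forall t, adapted S f (c t)) ->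
  continuation c (fun=> f).
Proof.
by move=> fc t; split => //; near=> s; near=> z.
Unshelve. all: by end_near. Qed.

Lemma continuation_comp c phi (u : R -> R) : continuous u ->
  continuation c phi -> continuation (c \o u) (phi \o u).
Proof.
move=> uc cphi t; have [? near_t] := cphi (u t); split => //.
exact: (uc t _ near_t).
Qed.

(** Inside a chart the constant family [g] is itself a continuation; only the
    part of [c] between [a] and [b] lies in the chart, hence the retraction. *)
Lemma continuation_in_chart c phi g (a b : R) : continuous c ->
  continuation c phi -> a <= b ->
  (forall r, a <= r <= b -> adapted S g (c r)) ->
  (\forall z \near c a, phi a z = g z) -> \forall z \near c b, phi b z = g z.
Proof.
move=> cc cphi ab gc E.
have cl := @continuous_clamp R a b.
have := @continuation_unique (c \o clamp a b) (phi \o clamp a b) (fun=> g) a b.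
rewrite /= !clamp_id ?lexx ?ab //; apply => //.
- by move=> t; apply: continuous_comp; [exact: cl | exact: cc].
- exact: continuation_comp.
- by apply: continuation_cst => t; apply: gc; exact: clamp_itv.
Qed.

Definition glue (T : Type) (a : R) (c d : R -> T) (t : R) : T :=
  if t <= a then c t else d t.

Lemma continuous_glue (T : topologicalType) (a : R) (c d : R -> T) :
  continuous c -> continuous d -> c a = d a -> continuous (glue a c d).
Proof.
move=> cc cd cda t B; rewrite nbhs_simpl /glue /=.
have [ta|ta|->] := ltgtP t a => nB.
- have n : \forall s \near t, B (c s) := cc t B nB.
  by apply: filterS2 n (lt_nbhsl ta) => s /= ? /ltW ->.
- have n : \forall s \near t, B (d s) := cd t B nB.
  by apply: filterS2 n (lt_nbhsr ta) => s /= ? /lt_geF ->.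
- have nc : \forall s \near a, B (c s) := cc a B nB.
  rewrite cda in nB; have nd : \forall s \near a, B (d s) := cd a B nB.
  by apply: filterS2 nc nd => s /= ? ?; case: ifP.
Qed.

Lemma continuation_glue (a : R) c d phi psi : continuous c -> continuous d ->
  c a = d a -> continuation c phi -> continuation d psi ->
  (\forall z \near c a, phi a z = psi a z) ->
  continuation (glue a c d) (glue a phi psi).
Proof.
move=> cc cd cda cphi cpsi E t; rewrite /glue.
have [ta|ta|->] := ltgtP t a.
- have [? near_t] := cphi t; split => //.
  by apply: filterS2 near_t (lt_nbhsl ta) => s /= ? /ltW ->.
- have [? near_t] := cpsi t; split => //.
  by apply: filterS2 near_t (lt_nbhsr ta) => s /= ? /lt_geF ->.
- have [? near_c] := cphi a; split => //.
  have [_ near_d] := cpsi a.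
  have near_E : \forall s \near a, \forall z \near d s, phi a z = psi a z.
    have n := near_join E; rewrite cda in n; exact: (cd a _ n).
  apply: filterS3 near_c near_d near_E => s /= Ec Ed Es.
  by case: ifP => _ //; apply: filterS2 Ed Es => z -> ->.
Qed.

(** A germ reached at time [s] inside a chart is of the form [e * fU + k] for
    the coordinate [fU] of that chart, and then extends over the whole chart. *)
Lemma continuation_exists c f : continuous c -> adapted S f (c 0) ->
  exists2 phi, continuation (c \o clamp 0 1) phi & phi 0 = f.
Proof.
move=> cc f0.
pose P T := exists2 phi, continuation (c \o clamp 0 T) phi & phi 0 = f.
apply: (interval_chaining (P := P) ler01); last first.
  exists (fun=> f) => //; apply: continuation_cst => t /=.
  rewrite (_ : clamp 0 0 t = 0) //; apply: le_anti.
  by rewrite andbC; exact: clamp_itv.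
move=> t; have [U [fU [[oU Ut] adU _ _ _]]] := adapted_exists S (c t).
exists (c @^-1` U); first by apply: (cc t); apply: open_nbhs_nbhs; split.
move=> s s' s0 ss' B [phi cphi phi0].
have Us : U (c s) by apply: B; rewrite lexx.
have [phis _] := cphi s; rewrite /= clamp_id ?s0 ?lexx // in phis.
have [e [k [e1 E]]] := adapted_unique (adU _ Us) phis.
exists (glue s phi (fun=> fun z => e * fU z + k)); last by rewrite /glue s0.
have -> : c \o clamp 0 s' = glue s (c \o clamp 0 s) (c \o clamp s s').
  by apply/funext => r; rewrite /glue /= (clamp_split _ s0 ss'); case: ifP.
have ccl a b : continuous (c \o clamp a b).
  by move=> r; apply: continuous_comp; [exact: continuous_clamp | exact: cc].
apply: continuation_glue => //.
- by rewrite /= !clamp_id ?s0 ?lexx ?ss'.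
- apply: continuation_cst => r /=; apply: adapted_affine => //; apply: adU.
  by apply: B; exact: clamp_itv.
- by rewrite /= clamp_id ?s0 ?lexx.
Qed.

(** Local constancy of the final germ in a family of paths: a chart around
    [H (s0, t)] contains the nearby paths during a whole interval of time, over
    which all of them continue the same germ [e * fU + k]. *)
Lemma continuation_stable (H : R * R -> M) (phi : R -> R -> M -> R) (s0 : R) :
  continuous H -> (forall s, continuation (fun t => H (s, t)) (phi s)) ->
  (\forall s \near s0, \forall z \near H (s, 0), phi s 0 z = phi s0 0 z) ->
  \forall s \near s0, \forall z \near H (s, 1), phi s 1 z = phi s0 1 z.
Proof.
move=> Hc cphi; apply: (interval_chaining (P := fun t : R => \forall s \near s0,
  \forall z \near H (s, t), phi s t z = phi s0 t z) ler01) => t.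
have Hs s : continuous (fun t => H (s, t)).
  apply: (continuousT_comp (f := fun t => (s, t)) (g := H)) => //.
  by apply: continuous_pair; [exact: cst_continuous | move=> ?; exact: cvg_id].
have Ht r : continuous (fun s => H (s, r)).
  apply: (continuousT_comp (f := fun s => (s, r)) (g := H)) => //.
  by apply: continuous_pair; [move=> ?; exact: cvg_id | exact: cst_continuous].
have near_Ht r (Q : M -> Prop) : (\forall z \near H (s0, r), Q z) ->
    \forall s \near s0, \forall z \near H (s, r), Q z.
  by move=> /near_join n; exact: (Ht r s0 _ n).
have [U [fU [[oU Ut] adU _ _ _]]] := adapted_exists S (H (s0, t)).
have nU : nbhs (H (s0, t)) U by apply: open_nbhs_nbhs; split.
have [[A B] /= [nA nB] AB] := Hc (s0, t) U nU.
exists B => // a b _ ab Bab near_a.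
have adab s r : A s -> a <= r <= b -> adapted S fU (H (s, r)).
  by move=> As rab; apply: adU; apply: (AB (s, r)); split => //; exact: Bab.
have As0 : A s0 by exact: nbhs_singleton.
have aab : a <= a <= b by rewrite lexx.
have [e [k [e1 E]]] := adapted_unique (adab _ _ As0 aab) (cphi s0 a).1.
have adg s r : A s -> a <= r <= b ->
    adapted S (fun z => e * fU z + k) (H (s, r)).
  by move=> As rab; apply: adapted_affine => //; exact: adab.
have Es0 := continuation_in_chart (Hs s0) (cphi s0) ab (adg s0 ^~ As0) E.
apply: filterS3 (filterI nA near_a) (near_Ht _ _ E) (near_Ht _ _ Es0).
move=> s [As Es] Esa Esb.
have Es' : \forall z \near H (s, a), phi s a z = e * fU z + k.
  by apply: filterS2 Es Esa => z -> ->.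
have := continuation_in_chart (Hs s) (cphi s) ab (adg s ^~ As) Es'.
by apply: filterS2 Esb => z -> ->.
Qed.

Lemma continuation_homotopy (H : R * R -> M) (x y : M) phi psi : continuous H ->
  (forall s, H (s, 0) = x) -> (forall s, H (s, 1) = y) ->
  continuation (fun t => H (0, clamp 0 1 t)) phi ->
  continuation (fun t => H (1, clamp 0 1 t)) psi ->
  (\forall z \near x, phi 0 z = psi 0 z) ->
  \forall z \near y, phi 1 z = psi 1 z.
Proof.
move=> Hc Hx Hy cphi cpsi E.
have Hs s : continuous (fun t => H (s, t)).
  apply: (continuousT_comp (f := fun t => (s, t)) (g := H)) => //.
  by apply: continuous_pair; [exact: cst_continuous | move=> ?; exact: cvg_id].
have c00 : clamp 0 1 0 = 0 :> R by rewrite clamp_id ?lexx ?ler01.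
have c11 : clamp 0 1 1 = 1 :> R by rewrite clamp_id ?lexx ?ler01.
(* Each path of the homotopy carries a continuation of the same germ; the final
   germ is locally constant in [s], hence constant. *)
have ex s : exists p, continuation (fun t => H (s, clamp 0 1 t)) p /\
    p 0 = phi 0.
  have [||p cp p0] := @continuation_exists (fun t => H (s, t)) (phi 0).
  - exact: Hs.
  - by have [a0 _] := cphi 0; rewrite c00 Hx in a0; rewrite /= Hx.
  - by exists p.
have [p /all_and2[cp p0]] := choice ex.
pose H' (st : R * R) := H (st.1, clamp 0 1 st.2).
have H'c : continuous H'.
  apply: (continuousT_comp (f := fun st : R * R => (st.1, clamp 0 1 st.2))
    (g := H)) => //.
  apply: continuous_pair; first by move=> ?; exact: cvg_fst.
  apply: (continuousT_comp (f := snd)); first by move=> ?; exact: cvg_snd.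
  exact: continuous_clamp.
have stable s0 : \forall s \near s0, \forall z \near y, p s 1 z = p s0 1 z.
  have := @continuation_stable H' p s0 H'c cp.
  rewrite /H' /= c00 c11.
  move=> st; apply: filterS (st _) => [s|]; first by rewrite Hy.
  by near=> s; rewrite !p0; near=> z.
have p01 : \forall z \near y, p 0 1 z = p 1 1 z.
  apply: (interval_chaining (P := fun s : R =>
    \forall z \near y, p 0 1 z = p s 1 z) ler01); last by near=> z.
  move=> s; exists [set r | \forall z \near y, p r 1 z = p s 1 z].
    exact: stable.
  move=> a b _ ab B Ea.
  have Bas : \forall z \near y, p a 1 z = p s 1 z by apply: B; rewrite lexx.
  have Bbs : \forall z \near y, p b 1 z = p s 1 z by apply: B; rewrite lexx ab.
  by apply: filterS3 Ea Bas Bbs => z -> -> ->.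
have cs s : continuous (fun t => H (s, clamp 0 1 t)).
  by apply: continuousT_comp (Hs s); exact: continuous_clamp.
have E0 := continuation_unique (cs 0) (cp 0) cphi ler01.
have E1 := continuation_unique (cs 1) (cp 1) cpsi ler01.
rewrite /= c00 c11 !Hx !Hy !p0 in E0 E1.
have E0' : \forall z \near y, p 0 1 z = phi 1 z by apply: E0; near=> z.
have E1' := E1 E; by apply: filterS3 p01 E0' E1' => z <- <- <-.
Unshelve. all: by end_near. Qed.

(** Transport in the sheaf of adapted germs; the path is left implicit because
    only the germs that can be reached matter. *)
Definition transport (y : M) f (y' : M) g : Prop := exists c phi,
  [/\ continuous c, c 0 = y & c 1 = y'] /\
  [/\ continuation c phi, (\forall z \near y, phi 0 z = f z)
    & \forall z \near y', phi 1 z = g z].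

Lemma transport_chart (U : set M) f g (a b : M) : U a ->
  (forall z, U z -> adapted S g z) -> (\forall z \near a, f z = g z) ->
  (exists c : R -> M,
     [/\ continuous c, c 0 = a, c 1 = b & forall t, U (c t)]) ->
  transport a f b g.
Proof.
move=> Ua Ug fg [c [cc c0 c1 Uc]]; exists c, (fun=> g); split => //; split.
- by apply: continuation_cst => t; apply: Ug.
- by apply: filterS fg.
- by near=> z.
Unshelve. all: by end_near. Qed.

Lemma transport_trans y y' y'' f g h :
  transport y f y' g -> transport y' g y'' h -> transport y f y'' h.
Proof.
move=> [c [phi [[cc c0 c1] [cphi f0 g1]]]] [d [psi [[dc d0 d1] [dpsi g0 h1]]]].
pose u (t : R) := t * 2; pose v (t : R) := t * 2 - 1.
have uc : continuous u by apply: mulrr_continuous.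
have vc : continuous v.
  by move=> t; apply: cvgB; [exact: uc | exact: cvg_cst].
have u2 : u 2^-1 = 1 by rewrite /u mulVf.
have v2 : v 2^-1 = 0 by rewrite /v mulVf // subrr.
have cd : (c \o u) 2^-1 = (d \o v) 2^-1 by rewrite /= u2 v2 c1.
exists (glue 2^-1 (c \o u) (d \o v)), (glue 2^-1 (phi \o u) (psi \o v)).
have h0 : (0 <= 2^-1 :> R) by rewrite invr_ge0.
have h1' : (1 <= 2^-1 :> R) = false by apply/negbTE; rewrite -ltNge; lra.
have u0 : u 0 = 0 by rewrite /u mul0r.
have v1 : v 1 = 1 by rewrite /v; lra.
have cu := continuousT_comp uc cc; have dv := continuousT_comp vc dc.
split; split.
- exact: continuous_glue.
- by rewrite /glue h0 /= u0.
- by rewrite /glue h1' /= v1.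
- apply: continuation_glue => //; [exact: continuation_comp.. | ].
  by rewrite /= u2 v2 c1; apply: filterS2 g1 g0 => z -> ->.
- by rewrite /glue h0 /= u0.
- by rewrite /glue h1' /= v1.
Qed.

Section Compact.
Hypothesis Mcompact : compact [set: M].

(** In a chart the coordinate takes larger and smaller values than at the
    centre.  The germ [f] is that coordinate up to an isometry, so one of the
    two directions increases [f]; the amount is uniform by compactness. *)
Lemma transport_gain : exists2 e : R, 0 < e & forall y f, adapted S f y ->
  exists y' g, [/\ adapted S g y', transport y f y' g & f y + e <= g y'].
Proof.
pose P (e : R) y := forall f, adapted S f y ->
  exists y' g, [/\ adapted S g y', transport y f y' g & f y + e <= g y'].
suff : \forall e \near 0^'+, [set: M] `<=` P e.
  move=> near_P; near (0 : R)^'+ => e; exists e => // y f fy.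
  by have := near near_P e; apply.
apply: (compact_near_coveringP [set: M]).1 => // y _.
have [U [fU [[oU Uy] adU fUc pU [a [b [Ua Ub /andP[ay yb]]]]]]] :=
  adapted_exists S y.
(* The other half of the room is left for moving the starting point from [y] to
   [y']. *)
pose d := Num.min (fU b - fU y) (fU y - fU a) / 2.
have d0 : 0 < d by rewrite divr_gt0 // lt_min !subr_gt0 ay yb.
have da : d * 2 <= fU y - fU a by rewrite divfK // ge_min lexx orbT.
have db : d * 2 <= fU b - fU y by rewrite divfK // ge_min lexx.
have nU : nbhs y U by apply: open_nbhs_nbhs.
near=> y' e => f fy'.
have Uy' : U y' by near: y'.
have fUy' : `|fU y - fU y'| < d by near: y'; move/cvgrPdist_lt: fUc; apply.
have ed : e <= d by near: e; exact: nbhs_right_le.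
have [s [k [s1 E]]] := adapted_unique (adU _ Uy') fy'.
have adg z : U z -> adapted S (fun z => s * fU z + k) z.
  by move=> Uz; apply: adapted_affine => //; exact: adU.
rewrite (nbhs_singleton E).
move: fUy'; rewrite ltr_norml => /andP[l r].
case: (s1) => s_eq.
  exists b, (fun z => s * fU z + k); split; first exact: adg.
    exact: (transport_chart (U := U)) (pU _ _ Uy' Ub).
  by rewrite /= s_eq; lra.
exists a, (fun z => s * fU z + k); split; first exact: adg.
  exact: (transport_chart (U := U)) (pU _ _ Uy' Ua).
by rewrite /= s_eq; lra.
Unshelve. all: by end_near. Qed.

(** Inside a chart all points are joined with a bounded loss, so the points
    from which [x] is reached with some bounded loss form an open and closed
    set; compactness makes the bound uniform. *)
Lemma transport_back (x : M) : connected [set: M] -> exists L : R,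
  forall y f, adapted S f y -> exists2 g, transport y f x g & f y - L <= g x.
Proof.
move=> Mconn.
pose P (L : R) y := forall f, adapted S f y ->
  exists2 g, transport y f x g & f y - L <= g x.
have near_P y : exists2 U : set M, open U /\ U y & forall a b L, U a -> U b ->
    P L b -> exists L', P L' a.
  have [U [fU [[oU Uy] adU fUc pU _]]] := adapted_exists S y.
  exists U => // a b L Ua Ub PL; exists (L + `|fU a - fU b|) => f fa.
  have [s [k [s1 E]]] := adapted_unique (adU _ Ua) fa.
  have adg z : U z -> adapted S (fun z => s * fU z + k) z.
    by move=> Uz; apply: adapted_affine => //; exact: adU.
  have [g gx gL] := PL _ (adg _ Ub); exists g.
    by apply: transport_trans gx;
      exact: (transport_chart (U := U)) (pU _ _ Ua Ub).
  rewrite (nbhs_singleton E).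
  have := ler_norm (fU a - fU b); have := ler_norm (fU b - fU a).
  by rewrite (distrC (fU b)); move: gL; case: s1 => ->; lra.
have allP : [set y | exists L, P L y] = [set: M].
  apply: Mconn.
  - exists x, 0 => f fx; exists f; last by rewrite subr0.
    exists (fun=> x), (fun=> f); split; [by split => // t; exact: cvg_cst|].
    by split; [exact: continuation_cst | near=> z..].
  - exists [set y | exists L, P L y]; last by rewrite setTI.
    rewrite openE => y [L PL]; have [U oU UP] := near_P y.
    apply: filterS (open_nbhs_nbhs oU) => z Uz.
    by apply: UP PL => //; case: oU.
  - exists [set y | exists L, P L y]; last by rewrite setTI.
    rewrite -[X in closed X]setCK closedC openE => y nPy.
    have [U oU UP] := near_P y.
    apply: filterS (open_nbhs_nbhs oU) => z Uz [L PL]; apply: nPy.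
    by apply: UP PL => //; case: oU.
suff : \forall L \near +oo, [set: M] `<=` P L.
  move=> nP; near (pinfty_nbhs R) => L; exists L => y f fy.
  by have := near nP L; apply.
apply: (compact_near_coveringP [set: M]).1 => // y _.
have [U [fU [[oU Uy] adU fUc pU _]]] := adapted_exists S y.
have nU : nbhs y U by apply: open_nbhs_nbhs.
have [L PL] : [set y | exists L, P L y] y by rewrite allP.
near=> y' L' => f fy'.
have Uy' : U y' by near: y'.
have fUy' : `|fU y - fU y'| < 1 by near: y'; move/cvgrPdist_lt: fUc; apply.
have LL' : L + 1 <= L' by near: L'; apply: nbhs_pinfty_ge; rewrite num_real.
have [s [k [s1 E]]] := adapted_unique (adU _ Uy') fy'.
have adg z : U z -> adapted S (fun z => s * fU z + k) z.
  by move=> Uz; apply: adapted_affine => //; exact: adU.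
have [g gx gL] := PL _ (adg _ Uy); exists g.
  by apply: transport_trans gx;
    exact: (transport_chart (U := U)) (pU _ _ Uy' Uy).
rewrite (nbhs_singleton E).
move: fUy'; rewrite ltr_norml => /andP[l r].
by move: gL LL' => /=; case: s1 => ->; lra.
Unshelve. all: by end_near. Qed.

Lemma transport_loop_unbounded (x : M) f (m : R) : connected [set: M] ->
  adapted S f x -> exists2 g, transport x f x g & m <= g x.
Proof.
move=> Mconn fx; have [e e0 gain] := transport_gain.
have [L back] := transport_back x Mconn.
have climb n : exists y g,
    [/\ adapted S g y, transport x f y g & f x + n%:R * e <= g y].
  elim: n => [|n [y [g [gy fg le_g]]]].
    exists x, f; split; rewrite ?mul0r ?addr0 //.
    exists (fun=> x), (fun=> f); split; [by split => // t; exact: cvg_cst|].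
    by split; [exact: continuation_cst | near=> z..].
  have [y' [g' [gy' gg' le_g']]] := gain _ _ gy.
  exists y', g'; split => //; first exact: transport_trans gg'.
  by rewrite -natr1 mulrDl mul1r; lra.
have [n nm] : exists n : nat, (m + L - f x) / e <= n%:R.
  by exists (Num.truncn `|(m + L - f x) / e|).+1; apply: le_trans (ler_norm _) _;
    apply/ltW/truncnS_gt.
have [y [g [gy fg le_g]]] := climb n.
have [h gh le_h] := back _ _ gy; exists h; first exact: transport_trans gh.
move: nm; rewrite ler_pdivrMr // => nm; lra.
Unshelve. all: by end_near. Qed.

Theorem infinite_pi1_of_transverse_structure (x : M) :
  connected [set: M] -> infinite_set (@pi1 R M x).
Proof.
move=> Mconn fin.
have [U [f [[_ Ux] adf _ _ _]]] := adapted_exists S x.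
have {U Ux adf} fx := adf _ Ux.
(* The value at [x] after continuation along the loop is the invariant that
   distinguishes homotopy classes. *)
pose D c v := exists phi, [/\ continuation (c \o clamp 0 1) phi,
  \forall z \near x, phi 0 z = f z & phi 1 x = v].
have D_homotopy c d v w : loop_at x c -> homotopic_loops x c d ->
    D c v -> D d w -> v = w.
  move=> cx [H [Hc H0 H1 Hx]] [phi [cphi phi0 <-]] [psi [cpsi psi0 <-]].
  pose K (st : R * R) := H (clamp 0 1 st.1, clamp 0 1 st.2).
  have cl01 (t : R) : clamp 0 1 t \in `[0, 1].
    by rewrite in_itv /=; exact: clamp_itv.
  have clc := @continuous_clamp R 0 1.
  have Kc : continuous K.
    apply: (continuous_within_comp
      (g := fun st : R * R => (clamp 0 1 st.1, clamp 0 1 st.2))) Hc _ _.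
      by move=> [s t]; split => /=; exact: cl01.
    apply: continuous_pair.
      by apply: (continuousT_comp (f := fst)) => // ?; exact: cvg_fst.
    by apply: (continuousT_comp (f := snd)) => // ?; exact: cvg_snd.
  have c00 : clamp 0 1 0 = 0 :> R by rewrite clamp_id ?lexx ?ler01.
  have c11 : clamp 0 1 1 = 1 :> R by rewrite clamp_id ?lexx ?ler01.
  have clK (t : R) : clamp 0 1 (clamp 0 1 t) = clamp 0 1 t.
    by rewrite clamp_id // clamp_itv.
  apply: nbhs_singleton (continuation_homotopy Kc (x := x) _ _ _ _ _).
  - by move=> s; rewrite /K /= c00; have [] := Hx _ (cl01 s).
  - by move=> s; rewrite /K /= c11; have [] := Hx _ (cl01 s).
  - rewrite /K /= c00; under eq_fun do rewrite clK H0 ?cl01 //; exact: cphi.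
  - rewrite /K /= c11; under eq_fun do rewrite clK H1 ?cl01 //; exact: cpsi.
  - by apply: filterS2 phi0 psi0 => z -> ->.
have D_exists c : loop_at x c -> exists v, D c v.
  move=> [cc c0 c1].
  have [||phi cphi phi0] := @continuation_exists (c \o clamp 0 1) f.
  - apply: continuous_within_comp cc _ _; last exact: continuous_clamp.
    by move=> t; rewrite /= in_itv /=; exact: clamp_itv.
  - by rewrite /= clamp_id ?lexx ?ler01 // c0.
  - exists (phi 1 x), phi; split => //; last by rewrite phi0; near=> z.
    rewrite (_ : c \o clamp 0 1 = c \o clamp 0 1 \o clamp 0 1) //.
    by apply/funext => t /=; rewrite [in RHS]clamp_id // clamp_itv.
have bound A : exists b : R, pi1 x A -> forall c v, A c -> D c v -> v = b.
  have [[c cx <-]|nA] := pselect (pi1 x A); last by exists 0.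
  have [w Dw] := D_exists _ cx.
  exists w => _ d v [dx cd] Dv; exact/esym/(D_homotopy c d).
have [b bP] := choice bound.
(* With finitely many classes, the sum of the absolute values bounds the
   invariant of every loop. *)
have /finite_seqP[s As] := fin.
have [g [c [phi [[cc c0 c1] [cphi phi0 phi1]]]] mg] :=
  transport_loop_unbounded (\sum_(A <- s) `|b A| + 1) Mconn fx.
have cx : loop_at x c by split => //; exact: continuous_subspaceT.
have cA : pi1 x (homotopy_class x c) by exists c.
have cc' : homotopy_class x c c.
  split => //; exists (c \o snd); split; [|by []|by []|by move=> t _; split].
  apply: continuous_subspaceT; apply: continuousT_comp cc => ?; exact: cvg_snd.
have Dg : D c (g x).
  exists (phi \o clamp 0 1); split.
  - by apply: continuation_comp => //; exact: continuous_clamp.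
  - by rewrite /= clamp_id ?lexx ?ler01.
  - by rewrite /= clamp_id ?lexx ?ler01 // (nbhs_singleton phi1).
have /= Eg := bP _ cA _ _ cc' Dg.
have sA : homotopy_class x c \in s.
  by have : [set` s] (homotopy_class x c) by rewrite -As.
have : b (homotopy_class x c) <= \sum_(A <- s) `|b A|.
  rewrite (big_rem _ sA) /=; apply: le_trans (ler_norm _) _.
  by rewrite lerDl sumr_ge0.
by rewrite -Eg; lra.
Unshelve. all: by end_near. Qed.

End Compact.
End Germs.

(** * Coordinate changes and tangent vectors *)

Lemma near_eq_diff (R : realType) (V W : normedModType R) (f g : V -> W) x :
  (\forall z \near x, f z = g z) -> differentiable f x ->
  differentiable g x /\ 'd g x = 'd f x :> (V -> W).
Proof.
move=> fg df.
have fgx := nbhs_singleton fg.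
have [dfc /eqaddoP E] := (diff_locallyP x f).1 df.
have Eg : g \o shift x = cst (g x) + 'd f x +o_ 0 id.
  apply/eqaddoP => e e0; have fg0 : \forall h \near 0, f (h + x) = g (h + x).
    have := fg; rewrite (near_shift 0 x) subr0.
    by apply: filterS => h.
  apply: filterS2 (E e e0) fg0 => h + E0.
  by rewrite !fctE /= E0 fgx.
have dg := diff_unique dfc Eg.
have gx : differentiable g x.
  apply/(diff_locallyP x g); split.
    rewrite dg; exact dfc.
  rewrite dg; exact Eg.
split; [exact gx | exact dg].
Qed.

Lemma mul_jacobian (R : realType) m n (f : 'rV[R]_m -> 'rV[R]_n) z v :
  v *m jacobian f z = 'd f z v.
Proof. by rewrite /jacobian mul_rV_lin1. Qed.

Section Transitions.
Context {R : realType} {n : nat} {M : smooth_manifold R n}.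
Implicit Types (phi psi : chart R n M) (x : M).

Lemma chart_img phi x : cdom phi x -> (phi @` cdom phi) (phi x).
Proof. by move=> ?; exists x. Qed.

Lemma near_cinv phi x (Q : M -> Prop) : cdom phi x ->
  (\forall y \near x, Q y) -> \forall z \near phi x, Q (cinv phi z).
Proof.
move=> phix Qx; have Qx' : nbhs (cinv phi (phi x)) Q by rewrite cfunK.
exact: (cinv_cont (chart_img phix) Qx').
Qed.

Lemma near_chart phi x (Q : 'rV[R]_n -> Prop) : cdom phi x ->
  (\forall z \near phi x, Q z) -> \forall y \near x, Q (phi y).
Proof. by move=> phix Qx; exact: (cfun_cont phix Qx). Qed.

Lemma near_cdom phi x : cdom phi x -> \forall y \near x, cdom phi y.
Proof. by move=> phix; apply: open_nbhs_nbhs; split => //; exact: cdom_open. Qed.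

Lemma cinvK phi z : (phi @` cdom phi) z -> cdom phi (cinv phi z) /\
  phi (cinv phi z) = z.
Proof. by move=> [x phix <-]; rewrite cfunK. Qed.

Lemma near_cimg phi x : cdom phi x ->
  \forall z \near phi x, (phi @` cdom phi) z.
Proof.
move=> phix; apply: open_nbhs_nbhs; split; first exact: cimg_open.
exact: chart_img.
Qed.

Lemma atlas_transition_differentiable phi chi x : smooth_chart phi ->
  atlas chi -> cdom phi x -> cdom chi x ->
  differentiable (transition phi chi) (phi x) /\
  differentiable (transition chi phi) (chi x).
Proof.
move=> /[apply] -[/(_ 1)[d1 _] /(_ 1)[d2 _]] phix chix.
by split; [apply: d1 | apply: d2]; exists x.
Qed.

Lemma near_transition_comp phi psi chi x :
  cdom phi x -> cdom psi x -> cdom chi x ->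
  \forall z \near phi x,
    (transition psi chi \o transition phi psi) z = transition phi chi z.
Proof.
move=> phix psix chix; have := near_cinv phix (near_cdom psix).
by apply: filterS => z /= h; rewrite /transition /= cfunK.
Qed.

Lemma transition_chart phi psi x : cdom phi x ->
  transition phi psi (phi x) = psi x.
Proof. by move=> phix; rewrite /transition /= cfunK. Qed.

(** Two charts of the maximal atlas are compared through a chart of the atlas
    around the point. *)
Lemma transition_differentiable phi psi x :
  smooth_chart phi -> smooth_chart psi -> cdom phi x -> cdom psi x ->
  differentiable (transition phi psi) (phi x).
Proof.
move=> sphi spsi phix psix; have [chi achi chix] := atlas_cover x.
have E := near_transition_comp phix chix psix.
apply: (near_eq_diff E _).1; apply: differentiable_comp.
  by have [] := atlas_transition_differentiable sphi achi phix chix.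
rewrite transition_chart //.
by have [] := atlas_transition_differentiable spsi achi psix chix.
Qed.

Lemma diff_transition_comp phi psi chi x :
  smooth_chart phi -> smooth_chart psi -> smooth_chart chi ->
  cdom phi x -> cdom psi x -> cdom chi x ->
  'd (transition phi chi) (phi x) =
  'd (transition psi chi) (psi x) \o 'd (transition phi psi) (phi x)
    :> ('rV[R]_n -> 'rV[R]_n).
Proof.
move=> sphi spsi schi phix psix chix.
have d1 := transition_differentiable sphi spsi phix psix.
have d2 := transition_differentiable spsi schi psix chix.
have E := near_transition_comp phix psix chix.
rewrite -(transition_chart psi phix) in d2 *.
have [_ Ed] := near_eq_diff E (differentiable_comp d1 d2).
exact (eq_trans Ed (diff_comp d1 d2)).
Qed.

Lemma jacobian_transition_comp phi psi chi x (v : 'rV[R]_n) :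
  smooth_chart phi -> smooth_chart psi -> smooth_chart chi ->
  cdom phi x -> cdom psi x -> cdom chi x ->
  v *m jacobian (transition phi chi) (phi x) =
  v *m jacobian (transition phi psi) (phi x)
    *m jacobian (transition psi chi) (psi x).
Proof.
move=> sphi spsi schi phix psix chix.
have E := diff_transition_comp sphi spsi schi phix psix chix.
apply: etrans (mul_jacobian _ _ _) _.
apply: etrans (congr1 (fun f => f v) E) _.
apply/esym.
apply: etrans (mul_jacobian _ _ _) _.
exact: congr1 (mul_jacobian _ _ _).
Qed.

Lemma jacobian_transition_id phi x (v : 'rV[R]_n) : cdom phi x ->
  v *m jacobian (transition phi phi) (phi x) = v.
Proof.
move=> phix; have E : \forall z \near phi x, id z = transition phi phi z.
  have := near_cimg phix; apply: filterS => z phiz.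
  by rewrite /transition /= (cinvK phiz).2.
have [_ Ed] := near_eq_diff E (@ex_diff _ _ _ _ _ _ _ (is_diff_id (phi x))).
apply: etrans (mul_jacobian _ _ _) _.
apply: etrans (congr1 (fun f => f v) Ed) _.
have D := @diff_val _ _ _ _ _ _ _ (is_diff_id (phi x)).
exact (congr1 (fun f : 'rV[R]_n -> 'rV[R]_n => f v) D).
Qed.

(** The coordinates in the other charts are forced; the chain rule makes them
    consistent. *)
Lemma tangent_of_coord phi x (a : 'rV[R]_n) : smooth_chart phi -> cdom phi x ->
  exists v : tangent x, v phi = a.
Proof.
move=> sphi phix.
have change psi chi : smooth_chart psi -> smooth_chart chi ->
    cdom psi x -> cdom chi x ->
    a *m jacobian (transition phi chi) (phi x) =
    a *m jacobian (transition phi psi) (phi x)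
      *m jacobian (transition psi chi) (psi x).
  by move=> spsi schi psix chix; exact: jacobian_transition_comp.
by exists (Tangent change); rewrite /= jacobian_transition_id.
Qed.

End Transitions.

(** * The transverse coordinate of a foliated chart *)

Section Transversal.
Context {R : realType} {p : nat}.
Implicit Types (z v : 'rV[R]_(p + 1)).

Definition transv z : R := z 0 (rshift p ord0).

Definition unit_transv : 'rV[R]_(p + 1) := delta_mx 0 (rshift p ord0).

Lemma rsubmx_transv z : rsubmx z = (transv z)%:M.
Proof. by apply/matrixP => i j; rewrite !ord1 !mxE eqxx. Qed.

Lemma transvP z z' : rsubmx z = rsubmx z' <-> transv z = transv z'.
Proof.
split => [|E]; last by rewrite !rsubmx_transv E.
by move/matrixP/(_ 0 0); rewrite !mxE.
Qed.

Lemma rsubmx_eq0 z : rsubmx z = 0 <-> transv z = 0.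
Proof.
split => [/matrixP/(_ 0 0)|tz]; first by rewrite !mxE.
by rewrite rsubmx_transv tz raddf0.
Qed.

Lemma transvD z z' : transv (z + z') = transv z + transv z'.
Proof. by rewrite /transv !mxE. Qed.

Lemma transvB z z' : transv (z - z') = transv z - transv z'.
Proof. by rewrite /transv !mxE. Qed.

Lemma transvZ a z : transv (a *: z) = a * transv z.
Proof. by rewrite /transv !mxE. Qed.

Lemma transv_unit : transv unit_transv = 1.
Proof. by rewrite /transv /unit_transv mxE !eqxx. Qed.

Lemma continuous_transv : continuous transv.
Proof. exact: coord_continuous. Qed.

Lemma differentiable_transv z : differentiable transv z.
Proof. exact: differentiable_coord. Qed.

Lemma diff_transv z v : 'd transv z v = transv v.
Proof.
have @f : {linear 'rV[R]_(p + 1) -> R}.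
  by exists (fun N : 'rV[R]_(p + 1) => N 0 (rshift p ord0));
     do 2![eexists]; do ?[constructor];
     rewrite ?mxE// => ? *; rewrite ?mxE//; move=> ?; rewrite !mxE.
have fc : continuous f by exact: coord_continuous.
exact: (congr1 (fun h : 'rV[R]_(p + 1) -> R => h v) (diff_lin z fc)).
Qed.

End Transversal.

Section TransverseChange.
Context {R : realType} {p : nat} {M : smooth_manifold R (p + 1)}.
Variable F : foliation M.
Implicit Types (phi psi : chart R (p + 1) M) (x y : M).

Lemma diff_scalar (h : R -> R) (a b : R) : 'd h a b = b * 'd h a 1.
Proof. by rewrite -[in LHS](mulr1 b) -[b * 1]/(b *: (1 : R^o)) linearZ. Qed.

(** [h] is differentiable since it is [f] read along the line through [z] in
    the transverse direction, and the chain rule for [h \o transv] gives the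
    transverse part of the differential of [f]. *)
Lemma transverse_change_diff (f : 'rV[R]_(p + 1) -> 'rV[R]_(p + 1))
    (h : R -> R) z : differentiable f z ->
  (\forall z' \near z, transv (f z') = h (transv z')) ->
  differentiable h (transv z) /\
  forall v, transv ('d f z v) = transv v * 'd h (transv z) 1.
Proof.
move=> df E; set b := transv z.
pose l (t : R) : 'rV[R]_(p + 1) := z + (t - b) *: unit_transv.
have lb : l b = z by rewrite /l subrr scale0r addr0.
have tl t : transv (l t) = t.
  by rewrite /l transvD transvZ transv_unit mulr1 -/b addrC subrK.
have dl : differentiable l b.
  apply: differentiableD; first exact: differentiable_cst.
  apply: differentiableZl; apply: differentiableB; last exact: differentiable_cst.
  exact (@ex_diff _ _ _ _ _ _ _ (is_diff_id b)).
have df' : differentiable f (l b) by rewrite lb; exact df.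
have dtf : differentiable (transv \o f) z.
  by apply: differentiable_comp; [exact df | exact: differentiable_transv].
have dh : differentiable h b.
  apply: (near_eq_diff (f := transv \o (f \o l)) _ _).1.
    have El : \forall z' \near l b, transv (f z') = h (transv z').
      by rewrite lb.
    have nl : \forall t \near b, transv (f (l t)) = h (transv (l t)) :=
      differentiable_continuous dl El.
    by apply: filterS nl => t /=; rewrite tl.
  apply: differentiable_comp; last exact: differentiable_transv.
  by apply: differentiable_comp; [exact dl | exact df'].
split; first exact dh.
move=> v; have [_ Ed] := near_eq_diff E dtf.
have E1 := congr1 (fun f : 'rV[R]_(p + 1) -> R => f v)
  (diff_comp df (@differentiable_transv R p (f z))).
have E2 := congr1 (fun f : 'rV[R]_(p + 1) -> R => f v)
  (diff_comp (@differentiable_transv R p z) dh).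
have E3 := congr1 (fun f : 'rV[R]_(p + 1) -> R => f v) Ed.
have E4 := diff_transv z v.
have E5 := diff_transv (f z) ('d f z v).
apply: etrans (esym E5) _; apply: etrans (esym E1) _; apply: etrans (esym E3) _.
apply: etrans E2 _; apply: etrans (diff_scalar _ _ _) _.
exact (congr1 (fun a => a * 'd h b 1) E4).
Qed.

(** The one-variable function [h] and its derivative [h'] are the same for all
    points near [x].  In particular the transverse part of the differential is
    constant along plaques, which is what holonomy transport requires. *)
Lemma transverse_change phi psi x : fol_atlas F phi -> fol_atlas F psi ->
  cdom phi x -> cdom psi x -> exists h h' : R -> R,
  \forall y \near x, [/\ transv (psi y) = h (transv (phi y)),
    is_derive (transv (phi y)) 1 h (h' (transv (phi y))) &
    forall v, transv (v *m jacobian (transition phi psi) (phi y)) =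
      transv v * h' (transv (phi y))].
Proof.
move=> Fphi Fpsi phix psix.
have [H nH] : exists H : 'rV[R]_1 -> 'rV[R]_1, \forall z' \near phi x,
    rsubmx (transition phi psi z') = H (rsubmx z').
  by apply: (fol_transverse Fphi Fpsi); exists x.
pose h b := H b%:M 0 0; exists h, (fun b => 'd h b 1).
have nh : \forall z \near phi x, transv (transition phi psi z) = h (transv z).
  apply: filterS nH => z Ez; rewrite /h -rsubmx_transv -Ez rsubmx_transv.
  by rewrite mxE eqxx.
have := near_chart phix (near_join nh).
apply: filterS3 (near_cdom phix) (near_cdom psix) => y phiy psiy Ey.
have dt := transition_differentiable (fol_smooth Fphi) (fol_smooth Fpsi) phiy psiy.
have [dh dv] := transverse_change_diff dt Ey.
split.
- by rewrite -(nbhs_singleton Ey) transition_chart.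
- apply: DeriveDef; first by apply/derivable1_diffP; exact dh.
  exact: deriveE dh.
- by move=> v; apply: etrans (dv v); exact (congr1 transv (mul_jacobian _ _ _)).
Qed.

End TransverseChange.

(** * The transverse density of a bundle-like metric *)

Section Normal.
Context {R : realType} {p : nat}.
Implicit Types (G : 'M[R]_(p + 1)) (u v : 'rV[R]_(p + 1)).

Definition mx_form G u v : R := (u *m G *m v^T) 0 0.

Definition spd G := G^T = G /\
  forall a : 'rV[R]_(p + 1), a != 0 -> 0 < mx_form G a a.

Lemma mx_formC G u v : spd G -> mx_form G u v = mx_form G v u.
Proof.
move=> [sym _]; rewrite /mx_form -[in RHS]sym.
have -> : u *m G *m v^T = (v *m G^T *m u^T)^T by rewrite !trmx_mul !trmxK mulmxA.
by rewrite mxE.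
Qed.

Lemma mx_formBZl G a u u' v :
  mx_form G (u - a *: u') v = mx_form G u v - a * mx_form G u' v.
Proof. by rewrite /mx_form !mulmxBl -!scalemxAl !mxE. Qed.

Lemma mx_formZZ G a u : mx_form G (a *: u) (a *: u) = a ^+ 2 * mx_form G u u.
Proof. by rewrite /mx_form linearZ /= -!scalemxAl -scalemxAr scalerA mxE. Qed.

Lemma mul_unit_transv v : (unit_transv *m v^T) 0 0 = transv v.
Proof. by rewrite /unit_transv -rowE !mxE. Qed.

Lemma spd_unitmx G : spd G -> G \in unitmx.
Proof.
move=> [_ pos]; rewrite unitmxE unitfE; apply/negP => /det0P[v v0 vG].
by have := pos _ v0; rewrite /mx_form vG mul0mx mxE ltxx.
Qed.

(** The squared length of the covector [transv] for the dual of the metric with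
    matrix [G]. *)
Definition conormal G : R := invmx G (rshift p ord0) (rshift p ord0).

Lemma conormal_transv G : transv (unit_transv *m invmx G) = conormal G.
Proof. by rewrite /transv /unit_transv -rowE mxE. Qed.

Lemma conormal_gt0 G : spd G -> 0 < conormal G.
Proof.
move=> sG; have uG := spd_unitmx sG.
rewrite -conormal_transv; set b := unit_transv *m invmx G.
have bG : b *m G = unit_transv by rewrite mulmxKV.
have b0 : b != 0.
  apply/eqP => b0; have := @transv_unit R p.
  by rewrite -bG b0 mul0mx /transv mxE => /esym/eqP; rewrite oner_eq0.
by have := sG.2 _ b0; rewrite /mx_form bG mul_unit_transv.
Qed.

(** The gradient of [transv] for the metric [G], scaled to have transverse
    coordinate 1. *)
Definition unit_normal G := (conormal G)^-1 *: (unit_transv *m invmx G).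

Lemma transv_unit_normal G : spd G -> transv (unit_normal G) = 1.
Proof.
move=> /conormal_gt0 c0; rewrite transvZ conormal_transv mulVf //.
by rewrite gt_eqF.
Qed.

Lemma mx_form_unit_normal G v : spd G ->
  mx_form G (unit_normal G) v = (conormal G)^-1 * transv v.
Proof.
move=> /spd_unitmx uG.
by rewrite /mx_form /unit_normal -!scalemxAl mulmxKV // mxE mul_unit_transv.
Qed.

(** The vectors orthogonal to the hyperplane [transv = 0] are the multiples of
    [unit_normal G]. *)
Lemma mx_form_normal_sqr G v : spd G ->
  (forall u, transv u = 0 -> mx_form G u v = 0) ->
  mx_form G v v = transv v ^+ 2 * (conormal G)^-1.
Proof.
move=> sG nv; pose w := v - transv v *: unit_normal G.
have tw : transv w = 0.
  by rewrite transvB transvZ transv_unit_normal // mulr1 subrr.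
have w0 : w = 0.
  apply/eqP; apply: contraT => /sG.2.
  rewrite {1}/w mx_formBZl (mx_form_unit_normal _ sG) tw !mulr0 subr0.
  by rewrite (mx_formC _ _ sG) nv // ltxx.
have -> : v = transv v *: unit_normal G by apply/eqP; rewrite -subr_eq0 -/w w0.
rewrite transvZ transv_unit_normal // mulr1 mx_formZZ mx_form_unit_normal //.
by rewrite transv_unit_normal // mulr1.
Qed.

Lemma continuous_det (T : topologicalType) n (A : T -> 'M[R]_n) x :
  (forall i j, {for x, continuous (fun y => A y i j)}) ->
  {for x, continuous (fun y => \det (A y))}.
Proof.
move=> Ac; rewrite /continuous_at /determinant.
apply: (@cvg_big R _ +%R 0 xpredT); first exact: add_continuous.
move=> s _; apply: cvgM; first exact: cvg_cst.
apply: (@cvg_big R _ *%R 1 xpredT); first exact: mul_continuous.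
by move=> i _; exact: Ac.
Qed.

(** By Cramer's rule the entry of the inverse is a quotient of determinants. *)
Lemma continuous_conormal (T : topologicalType) (G : T -> 'M[R]_(p + 1)) x :
  {for x, continuous G} -> (\forall y \near x, spd (G y)) ->
  {for x, continuous (fun y => conormal (G y))}.
Proof.
move=> Gc sG; have Gij i j : {for x, continuous (fun y => G y i j)}.
  exact: (@continuous_comp _ _ _ G (fun N : 'M[R]_(p + 1) => N i j) x Gc
    (@coord_continuous R _ _ i j (G x))).
have detx : \det (G x) != 0.
  by have := spd_unitmx (nbhs_singleton sG); rewrite unitmxE unitfE.
pose l : 'I_(p + 1) := rshift p ord0.
have E : \forall y \near x, (\det (G y))^-1 * cofactor (G y) l l = conormal (G y).
  by apply: filterS sG => y /spd_unitmx uG; rewrite /conormal /invmx uG !mxE.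
have c : {for x, continuous (fun y => (\det (G y))^-1 * cofactor (G y) l l)}.
  apply: cvgM; first by apply: cvgV => //; exact: continuous_det.
  apply: cvgM; first exact: cvg_cst.
  apply: (@continuous_det T _ (fun y => row' l (col' l (G y)))) => i j.
  rewrite (_ : (fun y => _) = (fun y => G y (lift l i) (lift l j))).
    exact: Gij.
  by apply/funext => y; rewrite !mxE.
have Ex := nbhs_singleton E.
suff : (fun y => conormal (G y)) @ x --> conormal (G x) by [].
rewrite -Ex.
apply: cvg_trans c; apply: near_eq_cvg; exact: E.
Qed.

End Normal.

Section Density.
Context {R : realType} {p : nat} {M : smooth_manifold R (p + 1)}.
Variables (F : foliation M) (g : riemannian_metric M).
Implicit Types (phi psi : chart R (p + 1) M) (x y : M).

Lemma tcoord_transition phi psi x (u : tangent x) :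
  fol_atlas F phi -> fol_atlas F psi -> cdom phi x -> cdom psi x ->
  u psi = u phi *m jacobian (transition phi psi) (phi x).
Proof.
move=> Fphi Fpsi phix psix.
exact: (tcoord_change u (fol_smooth Fphi) (fol_smooth Fpsi) phix psix).
Qed.

(** The transverse coordinate of a vector is multiplied by a scalar when the
    foliated chart changes, so its vanishing is independent of the chart. *)
Lemma tangent_to_leaf_transv phi x (u : tangent x) : fol_atlas F phi ->
  cdom phi x -> transv (u phi) = 0 -> tangent_to_leaf F u.
Proof.
move=> Fphi phix u0 psi Fpsi psix.
have [h [h' nh]] := transverse_change Fphi Fpsi phix psix.
have [_ _ /(_ (u phi)) E] := nbhs_singleton nh.
have tu : transv (u psi) = 0.
  apply: etrans (congr1 transv (tcoord_transition u Fphi Fpsi phix psix)) _.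
  by apply: etrans E _; rewrite u0 mul0r.
exact/rsubmx_eq0.
Qed.

(** [lambda] is the metric induced on the normal bundle, a line bundle, in the
    transverse coordinate of [phi]. *)
Definition transverse_density phi (lambda : 'rV[R]_(p + 1) -> R) : Prop :=
  forall x, cdom phi x ->
  [/\ 0 < lambda (phi x), {for phi x, continuous lambda},
      exists v : tangent x, normal_to_leaf F g v /\ transv (v phi) = 1
    & forall v : tangent x, normal_to_leaf F g v ->
        g x v v = transv (v phi) ^+ 2 * lambda (phi x)].

Lemma transverse_density_exists phi : fol_atlas F phi ->
  exists lambda, transverse_density phi lambda.
Proof.
move=> Fphi; have [G [Gs Gsym Gpos Gin]] := inner_local g (fol_smooth Fphi).
have sG x : cdom phi x -> spd (G (phi x)).
  by move=> phix; split; [exact: Gsym | move=> a a0; exact: Gpos].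
exists (fun z => (conormal (G z))^-1) => x phix.
have c0 := conormal_gt0 (sG _ phix).
split.
- by rewrite /= invr_gt0.
- have cn : conormal (G (phi x)) != 0 by exact: lt0r_neq0.
  have cc : {for phi x, continuous (fun z => conormal (G z))}.
    apply: continuous_conormal; first exact: (Gs 0) (chart_img phix).
    by apply: filterS (near_cimg phix) => z [y phiy <-]; exact: sG.
  exact: (cvgV cn cc).
- have [v vE] := tangent_of_coord (unit_normal (G (phi x)))
    (fol_smooth Fphi) phix.
  exists v; split; last by rewrite vE transv_unit_normal //; exact: sG.
  move=> u /(_ _ Fphi phix) u0; apply: etrans (Gin _ _ _ phix) _.
  rewrite -[LHS]/(mx_form (G (phi x)) (u phi) (v phi)) vE.
  rewrite (mx_formC _ _ (sG _ phix)) mx_form_unit_normal; last exact: sG.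
  by rewrite ((rsubmx_eq0 _).1 u0) mulr0.
- move=> v nv; apply: etrans (Gin _ _ _ phix) _.
  apply: mx_form_normal_sqr; first exact: sG.
  move=> u u0; have [w wE] := tangent_of_coord u (fol_smooth Fphi) phix.
  rewrite -wE; apply: etrans (esym (Gin _ _ _ phix)) _; apply: nv.
  by apply: tangent_to_leaf_transv Fphi phix _; rewrite wE.
Qed.

(** Both sides are the squared length of the normal vector at [x] whose
    transverse coordinate in [phi] is 1; in [psi] that coordinate is [k]. *)
Lemma transverse_density_change phi psi lambda mu x (k : R) :
  fol_atlas F phi -> fol_atlas F psi -> cdom phi x -> cdom psi x ->
  transverse_density phi lambda -> transverse_density psi mu ->
  (forall v, transv (v *m jacobian (transition phi psi) (phi x)) =
     transv v * k) ->
  lambda (phi x) = k ^+ 2 * mu (psi x).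
Proof.
move=> Fphi Fpsi phix psix dl dm kE.
have [_ _ [v [nv v1]] gl] := dl x phix; have [_ _ _ gm] := dm x psix.
have vk : transv (v psi) = k.
  apply: etrans (congr1 transv (tcoord_transition v Fphi Fpsi phix psix)) _.
  by apply: etrans (kE _) _; rewrite v1 mul1r.
by rewrite -vk -gm // gl // v1 expr1n mul1r.
Qed.

Hypothesis g_bundle_like : bundle_like F g.

(** The straight segment from [z0] to [z1] lies in a plaque.  The normal field
    with transverse coordinate 1 along it is transported by holonomy, so its
    length is constant. *)
Lemma transverse_density_plaque phi lambda (z0 z1 : 'rV[R]_(p + 1)) :
  fol_atlas F phi -> transverse_density phi lambda ->
  (forall t : R, 0 <= t <= 1 -> (phi @` cdom phi) (z0 + t *: (z1 - z0))) ->
  transv z0 = transv z1 -> lambda z0 = lambda z1.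
Proof.
move=> Fphi dl img z01.
pose l (t : R) : 'rV[R]_(p + 1) := z0 + clamp 0 1 t *: (z1 - z0).
pose c (t : R) : M := cinv phi (l t).
have limg t : (phi @` cdom phi) (l t) by apply: img; exact: clamp_itv.
have cphi t : cdom phi (c t) by exact: (cinvK (limg t)).1.
have phic t : phi (c t) = l t by exact: (cinvK (limg t)).2.
have tl t : transv (l t) = transv z0.
  by rewrite /l transvD transvZ transvB z01 subrr mulr0 addr0.
have lc : continuous l.
  move=> t; apply: cvgD; first exact: cvg_cst.
  by apply: cvgZr_tmp; exact: continuous_clamp.
have cc : continuous c.
  move=> t; apply: continuous_comp; first exact: lc.
  exact: cinv_cont (limg t).
have ex t : exists v : tangent (c t),
    normal_to_leaf F g v /\ transv (v phi) = 1 by have [] := dl _ (cphi t).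
pose v t := sval (cid (ex t)).
have nv t : normal_to_leaf F g (v t) by exact: (svalP (cid (ex t))).1.
have tv t : transv (v t phi) = 1 by exact: (svalP (cid (ex t))).2.
have near_change psi t : fol_atlas F psi -> cdom psi (c t) ->
    \forall s \near t, transv (psi (c s)) = transv (psi (c t)) /\
      transv (v s psi) = transv (v t psi).
  move=> Fpsi psit; have [h [h' nh]] := transverse_change Fphi Fpsi (cphi t) psit.
  have value s : [/\ transv (psi (c s)) = h (transv (phi (c s))),
      is_derive (transv (phi (c s))) 1 h (h' (transv (phi (c s)))) &
      forall v, transv (v *m jacobian (transition phi psi) (phi (c s))) =
        transv v * h' (transv (phi (c s)))] -> cdom psi (c s) ->
      transv (psi (c s)) = h (transv z0) /\ transv (v s psi) = h' (transv z0).
    rewrite phic tl => -[-> _ E] psis; split => //.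
    have Ev := tcoord_transition (v s) Fphi Fpsi (cphi s) psis.
    apply: etrans (congr1 transv Ev) _; rewrite phic.
    by apply: etrans (E _) _; rewrite tv mul1r.
  have [-> ->] := value t (nbhs_singleton nh) psit.
  have n1 : \forall s \near t, cdom psi (c s) := cc t _ (near_cdom psit).
  have n2 := cc t _ nh.
  by apply: filterS2 n1 n2 => s psis /value; apply.
have c_leaf : leafwise_path F c.
  split; first exact: continuous_subspaceT.
  move=> psi t Fpsi _ psit; apply: filterS (near_change _ _ Fpsi psit) => s [E _] _.
  exact/transvP.
have v_transported : holonomy_transported F v.
  move=> psi t Fpsi _ psit; apply: filterS (near_change _ _ Fpsi psit) => s [_ E] _.
  exact/transvP.
have := g_bundle_like c_leaf (fun t _ => nv t) (fun t _ => nv t)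
  v_transported v_transported.
have gl t : g (c t) (v t) (v t) = lambda (l t).
  have [_ _ _ E] := dl _ (cphi t).
  by rewrite E // tv expr1n mul1r phic.
rewrite !gl /l !clamp_id ?lexx ?ler01 // scale1r scale0r addr0 addrC subrK.
exact: esym.
Qed.

End Density.

(** * Transverse coordinates by arc length *)

Section TransverseLine.
Context {R : realType} {p : nat} {M : smooth_manifold R (p + 1)}.
Implicit Types (phi : chart R (p + 1) M) (y : M).

Definition transverse_line (z : 'rV[R]_(p + 1)) (t : R) : 'rV[R]_(p + 1) :=
  z + (t - transv z) *: unit_transv.

Lemma transv_line z t : transv (transverse_line z t) = t.
Proof. by rewrite transvD transvZ transv_unit mulr1 addrC subrK. Qed.

Lemma transverse_line_id z : transverse_line z (transv z) = z.
Proof. by rewrite /transverse_line subrr scale0r addr0. Qed.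

Lemma continuous_transverse_line z : continuous (transverse_line z).
Proof.
move=> t; apply: cvgD; first exact: cvg_cst.
by apply: cvgZr_tmp; apply: cvgB; [exact: cvg_id | exact: cvg_cst].
Qed.

(** The transverse coordinate is continuous and open. *)
Lemma near_transv phi y (Q : R -> Prop) : cdom phi y ->
  (\forall z \near y, Q (transv (phi z))) <->
  \forall t \near transv (phi y), Q t.
Proof.
move=> phiy; split => [nQ|nQ]; last first.
  have n : \forall w \near phi y, Q (transv w).
    exact: (@continuous_transv R p (phi y) _ nQ).
  exact: near_chart phiy n.
have n : \forall w \near transverse_line (phi y) (transv (phi y)), Q (transv w).
  rewrite transverse_line_id.
  apply: filterS2 (near_cinv phiy nQ) (near_cimg phiy) => w + phiw.
  by rewrite (cinvK phiw).2.
have nl : \forall t \near transv (phi y), Q (transv (transverse_line (phi y) t)).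
  exact: (@continuous_transverse_line (phi y) _ _ n).
by apply: filterS nl => t; rewrite transv_line.
Qed.

End TransverseLine.

Section Adapted.
Context {R : realType} {p : nat} {M : smooth_manifold R (p + 1)}.
Variables (F : foliation M) (g : riemannian_metric M).
Implicit Types (phi psi : chart R (p + 1) M) (x y : M) (f : M -> R).

(** Up to sign and an additive constant, [f] is transverse arc length. *)
Definition isometric_coordinate f y : Prop :=
  exists phi lambda P dP, [/\ fol_atlas F phi, cdom phi y,
    transverse_density F g phi lambda &
    \forall z \near y, [/\ f z = P (transv (phi z)),
      is_derive (transv (phi z)) 1 P (dP (transv (phi z))) &
      dP (transv (phi z)) ^+ 2 = lambda (phi z)]].

Lemma isometric_coordinate_near f y : isometric_coordinate f y ->
  \forall z \near y, isometric_coordinate f z.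
Proof.
move=> [phi [lambda [P [dP [Fphi phiy dl nP]]]]].
apply: filterS2 (near_cdom phiy) (near_join nP) => z phiz nPz.
by exists phi, lambda, P, dP.
Qed.

Lemma isometric_coordinate_affine f y (s k : R) : s = 1 \/ s = -1 ->
  isometric_coordinate f y -> isometric_coordinate (fun z => s * f z + k) y.
Proof.
move=> s1 [phi [lambda [P [dP [Fphi phiy dl nP]]]]].
exists phi, lambda, (s *: P + cst k), (s *: dP); split => //.
apply: filterS nP => z [-> Pd sq]; split => //.
  have DE := is_deriveD (is_deriveZ s Pd) (is_derive_cst k (transv (phi z)) 1).
  by apply: is_derive_eq DE _; rewrite addr0.
rewrite -sq -[(s *: dP) _]/(s * dP _) exprMn.
by case: s1 => ->; rewrite ?sqrrN expr1n mul1r.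
Qed.

Lemma derive_near_eq (P Q : R -> R) (a b t : R) :
  (\forall u \near t, P u = Q u) -> is_derive t 1 P a -> is_derive t 1 Q b ->
  a = b.
Proof.
by move=> E Pa [_ <-]; have [_ ->] := near_eq_is_derive E Pa.
Qed.

Lemma isometric_coordinate_rigid f y (s k : R) : s = 1 \/ s = -1 ->
  isometric_coordinate f y -> (\forall z \near y, f z = s * f z + k) ->
  s = 1 /\ k = 0.
Proof.
move=> s1 [phi [lambda [P [dP [Fphi phiy dl nP]]]]] fE.
have PE : \forall t \near transv (phi y), P t = (s *: P + cst k) t.
  apply/(near_transv _ phiy); apply: filterS2 nP fE => z [fz _ _] E.
  by rewrite -[RHS]/(s * _ + k) -fz.
have [_ Pd sq] := nbhs_singleton nP.
have DE := is_deriveD (is_deriveZ s Pd) (is_derive_cst k (transv (phi y)) 1).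
have := derive_near_eq PE Pd DE.
rewrite addr0 -[s *: _]/(s * _).
have [l0 _ _ _] := dl y phiy.
have d0 : dP (transv (phi y)) != 0 by rewrite -sqrf_eq0 sq gt_eqF.
have := nbhs_singleton PE; rewrite -[RHS]/(s * _ + k).
case: s1 => -> /eqP; last first.
  by move=> _ dE; move/eqP: d0; case; lra.
by rewrite mul1r addrC -subr_eq subrr => /eqP <-.
Qed.

(** In the chart of [f], the function [f'] reads [Q \o h].  Its derivative has
    the same square as that of [P] by the change rule for densities. *)
Lemma isometric_coordinate_unique f f' y :
  isometric_coordinate f y -> isometric_coordinate f' y ->
  exists s k : R, (s = 1 \/ s = -1) /\ \forall z \near y, f' z = s * f z + k.
Proof.
move=> [phi [lambda [P [dP [Fphi phiy dl nP]]]]].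
move=> [psi [mu [Q [dQ [Fpsi psiy dm nQ]]]]].
have [h [h' nh]] := transverse_change Fphi Fpsi phiy psiy.
have : \forall t \near transv (phi y), [/\ is_derive (t : R) 1 P (dP t),
    is_derive (t : R) 1 (Q \o h) (dQ (h t) * h' t) &
    dP t != 0 /\ (dQ (h t) * h' t) ^+ 2 = dP t ^+ 2].
  apply/(near_transv _ phiy).
  apply: filter_app nP; apply: filter_app nQ; apply: filter_app nh.
  apply: filterS2 (near_cdom phiy) (near_cdom psiy) => z phiz psiz.
  move=> [hE hd hJ] [_ Qd sqQ] [_ Pd sqP].
  have [l0 _ _ _] := dl z phiz.
  rewrite hE in Qd sqQ; split; [exact Pd | exact: is_derive1_comp | split].
    by rewrite -sqrf_eq0 sqP gt_eqF.
  rewrite exprMn sqQ sqP mulrC.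
  exact/esym/(transverse_density_change Fphi Fpsi phiz psiz dl dm hJ).
move=> [e /= e0 ball_e]; set b := transv (phi y) in ball_e *.
have in_ball t : b - e < t < b + e -> `|b - t| < e.
  by rewrite ltr_norml; lra.
have [|||s [k [s1 QE]]] := @eq_sqr_derive R P (Q \o h) dP
    (fun t => dQ (h t) * h' t) (b - e) (b + e).
- by move=> t /in_ball /ball_e[].
- by move=> t /in_ball /ball_e[].
- by move=> t /in_ball /ball_e[].
exists s, k; split => //.
have nb : \forall z \near y, b - e < transv (phi z) < b + e.
  apply/(near_transv (fun t => b - e < t < b + e) phiy); exists e => //= t.
  by rewrite /ball_ /= ltr_norml -/b; lra.
apply: filter_app nP; apply: filterS3 nb nQ nh.
move=> z bz [-> _ _] [-> _ _] [-> _ _].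
exact: QE.
Qed.

Hypothesis g_bundle_like : bundle_like F g.

(** The coordinate is the primitive [P] of [sqrt lambda] along the transverse
    line through [y].  The chart domain is convex in coordinates, so that each
    of its points is joined to that line inside a plaque, where [lambda] is
    constant. *)
Lemma isometric_coordinate_exists y : exists U : set M, exists f : M -> R,
  [/\ open U /\ U y, (forall z, U z -> isometric_coordinate f z),
      {for y, continuous f},
      (forall a b, U a -> U b -> exists c : R -> M,
        [/\ continuous c, c 0 = a, c 1 = b & forall t, U (c t)])
    & exists a b, [/\ U a, U b & f a < f y < f b]].
Proof.
have [phi Fphi phiy] := fol_cover F y.
have [lambda dl] := transverse_density_exists g Fphi.
pose z0 := phi y; pose b0 := transv z0; pose l := transverse_line z0.
have l_b0 : l b0 = z0 by exact: transverse_line_id.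
have tl t : transv (l t) = t by exact: transv_line.
have lc : continuous l by exact: continuous_transverse_line.
have [r /= r0 ball_r] : exists2 r : R, 0 < r &
    forall z : 'rV[R]_(p + 1), `|z0 - z| < r -> (phi @` cdom phi) z.
  have /nbhs_ballP[r r0 br] := near_cimg phiy.
  by exists r => // z zr; apply: br; rewrite -ball_normE.
have [e /= e0 ball_e] : exists2 e : R, 0 < e &
    forall t : R, `|b0 - t| <= e -> `|z0 - l t| < r.
  have nz0 : \forall z \near l b0, `|z0 - z| < r.
    by rewrite l_b0; apply/nbhs_ballP; exists r => // z; rewrite -ball_normE.
  have [e /= e0 be] : \forall t \near b0, `|z0 - l t| < r := lc b0 _ nz0.
  exists (e / 2); first by rewrite divr_gt0.
  by move=> t te; apply: be; rewrite /ball_ /=; lra.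
(* The second condition places the projection of [z] to the transverse line in
   the first ball. *)
pose B (z : 'rV[R]_(p + 1)) := `|z0 - z| < r /\ `|b0 - transv z| < e.
have B_seg z z' t : B z -> B z' -> 0 <= t <= 1 -> B (z + t *: (z' - z)).
  move=> [z1 z2] [z'1 z'2] t01; split; first exact: ball_segment.
  rewrite transvD transvZ transvB.
  exact: (@ball_segment R R^o b0 (transv z) (transv z') e t).
have B_img z : B z -> (phi @` cdom phi) z by case=> /ball_r.
have B_line t : `|b0 - t| < e -> B (l t).
  by move=> te; split; [apply: ball_e; exact: ltW | rewrite tl].
have dist_near (V : normedModType R) (v w : V) (d : R) : `|v - w| < d ->
    \forall w' \near w, `|v - w'| < d.
  move=> vw; have c : (v - w') @[w' --> w] --> v - w.
    by apply: cvgB; [exact: cvg_cst | exact: cvg_id].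
  have := lt_nbhsl vw; exact: (cvg_norm c).
have B_open z : B z -> \forall z' \near z, B z'.
  move=> [z1 z2]; apply: filterI; first exact: (dist_near _ _ _ _ z1).
  exact: (continuous_transv (dist_near R^o _ _ _ z2)).
pose rho t := Num.sqrt (lambda (l t)).
have img_l t : b0 - e <= t <= b0 + e -> (phi @` cdom phi) (l t).
  by move=> te; apply/ball_r/ball_e; rewrite ler_norml; lra.
have rhoc t : b0 - e <= t <= b0 + e -> {for t, continuous rho}.
  move=> /img_l[x phix xE]; have [_ lcx _ _] := dl _ phix.
  apply: continuous_comp; last exact: sqrt_continuous.
  by apply: continuous_comp; [exact: lc | rewrite -xE].
have be : b0 - e < b0 + e by lra.
have [P Pd] := primitive_exists be rhoc.
have in_e (t : R) : `|b0 - t| < e -> b0 - e < t < b0 + e.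
  by rewrite ltr_norml; lra.
have rho0 t : b0 - e < t < b0 + e -> 0 < rho t.
  move=> te; rewrite sqrtr_gt0; have [|x phix <-] := img_l t; first lra.
  by have [] := dl _ phix.
have P_mono t u : b0 - e < t -> t < u -> u < b0 + e -> P t < P u.
  move=> te tu ue; have [c ctu E] := derive_MVT Pd te tu ue.
  by rewrite -subr_gt0 E mulr_gt0 ?subr_gt0 // rho0 //; lra.
pose U := [set x | cdom phi x /\ B (phi x)].
have U_near x : U x -> \forall x' \near x, U x'.
  move=> [phix Bx]; apply: filterI; first exact: near_cdom.
  exact: near_chart phix (B_open _ Bx).
have U_cinv z : B z -> U (cinv phi z) /\ phi (cinv phi z) = z.
  by move=> Bz; have [? E] := cinvK (B_img _ Bz); rewrite /U /= E.
exists U, (fun x => P (transv (phi x))); split.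
- split; first by rewrite openE => x; exact: U_near.
  by split => //; split; rewrite ?subrr normr0.
- move=> x Ux; have [phix Bx] := Ux.
  exists phi, lambda, P, rho; split => //.
  apply: filterS (U_near _ Ux) => x' [phix' Bx'].
  set t := transv (phi x'); have te : `|b0 - t| < e by case: Bx'.
  split => //; first by apply: Pd; exact: in_e.
  rewrite /rho sqr_sqrtr; last first.
    have [|x'' phix'' <-] := img_l t; first by have := in_e _ te; lra.
    by have [/ltW] := dl _ phix''.
  apply: (transverse_density_plaque g_bundle_like Fphi dl); last exact: tl.
  by move=> s s01; apply: B_img; apply: B_seg => //; exact: B_line.
- have Pc : {for b0, continuous P}.
    by apply: is_derive_continuous (Pd _ _); lra.
  apply: (@continuous_comp _ _ _ (fun x => transv (phi x)) P) => //.
  apply: (@continuous_comp _ _ _ phi transv); first exact: cfun_cont.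
  exact: continuous_transv.
- move=> a b [phia Ba] [phib Bb].
  pose c t := phi a + clamp 0 1 t *: (phi b - phi a).
  have Bc t : B (c t) by apply: B_seg => //; exact: clamp_itv.
  exists (cinv phi \o c); split.
  + move=> t; apply: continuous_comp; last exact: cinv_cont (B_img _ (Bc t)).
    apply: cvgD; first exact: cvg_cst.
    by apply: cvgZr_tmp; exact: continuous_clamp.
  + by rewrite /= /c clamp_id ?lexx ?ler01 // scale0r addr0 cfunK.
  + by rewrite /= /c clamp_id ?lexx ?ler01 // scale1r addrC subrK cfunK.
  + by move=> t; exact: (U_cinv _ (Bc t)).1.
- have [|Um Em] := U_cinv (l (b0 - e / 2)).
    by apply: B_line; rewrite ltr_norml; lra.
  have [|Up Ep] := U_cinv (l (b0 + e / 2)).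
    by apply: B_line; rewrite ltr_norml; lra.
  exists (cinv phi (l (b0 - e / 2))), (cinv phi (l (b0 + e / 2))); split => //.
  by rewrite Em Ep !tl; apply/andP; split; apply: P_mono; rewrite -/z0 -/b0; lra.
Qed.

End Adapted.

(** * The theorem *)

Theorem corollary6p7 (R : realType) (p : nat) (M : smooth_manifold R (p + 1))
    (F : foliation M) (hcompact : compact [set: M])
    (hconnected : connected [set: M]) (hF : riemannian_foliation F) (x : M) :
  infinite_set (@pi1 R M x).
Proof.
have [g gF] := hF.
pose S := TransverseStructure (@isometric_coordinate_near _ _ _ F g)
  (@isometric_coordinate_affine _ _ _ F g)
  (@isometric_coordinate_unique _ _ _ F g)
  (@isometric_coordinate_rigid _ _ _ F g) (isometric_coordinate_exists gF).
exact: (infinite_pi1_of_transverse_structure S).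
Qed.
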